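(* For each $n<\omega$ and each $A\in\mathcal{F}^\nabla_n$ there is a word $W\in\mathcal{W}_n$ such that $\nabla_nA=\nabla_nW$ is provable in $\mathrm{RC}^\nabla$.
   Context: Strictly positive formulas are built from propositional variables and $\top$ by $\land$ and unary modalities $\Diamond_n,\nabla_n$ ($n<\omega$). $\mathcal{F}^\nabla_n$ is the set of variable-free strictly positive formulas using only the modalities $\Diamond_i,\nabla_i$ with $i\ge n$. A word is a variable-free formula built from $\top$ using only $\Diamond$-modalities (no $\land$, no $\nabla$), i.e. $\Diamond_{i_1}\cdots\Diamond_{i_k}\top$; $\mathcal{W}_n$ is the set of words using only $\Diamond_i$ with $i\ge n$. $\mathrm{RC}^\nabla$ is the smallest set of sequents $A\vdash B$ containing the following axioms and closed under the following rules and under substitution: (1) $A\vdash A$; $A\vdash\top$; $A\land B\vdash A$; $A\land B\vdash B$; from $A\vdash B$, $B\vdash C$ infer $A\vdash C$; from $A\vdash B$, $A\vdash C$ infer $A\vdash B\land C$; from $A\vdash B$ infer $aA\vdash aB$ for each modality $a$; (2) $aaA\vdash aA$ for each modality $a$; (3) for $m<n$: $\Diamond_nA\vdash\Diamond_mA$, $\Diamond_nA\land\Diamond_mB\vdash\Diamond_n(A\land\Diamond_mB)$, and the same two with $\nabla$ in place of $\Diamond$; (4) $A\vdash\nabla_nA$, $\Diamond_nA\vdash\nabla_nA$; (5) for $m\le n$: $\Diamond_m\nabla_nA\vdash\Diamond_mA$, $\nabla_n\Diamond_mA\vdash\Diamond_mA$. $A=B$ means provability of $A\vdash B$ and $B\vdash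 A$. *)

(* Defs.v *)
From mathcomp Require Import all_boot.

Set Implicit Arguments.
Unset Strict Implicit.
Unset Printing Implicit Defensive.

Inductive modality : Type := Diamond of nat | Nabla of nat.

Definition mod_index (a : modality) : nat :=
  match a with Diamond i => i | Nabla i => i end.

Inductive formula : Type :=
  | Var of nat
  | Top
  | And of formula & formula
  | Mod of modality & formula.

Notation Dia n A := (Mod (Diamond n) A).
Notation Nab n A := (Mod (Nabla n) A).

Fixpoint subst (s : nat -> formula) (A : formula) : formula :=
  match A with
  | Var p => s p
  | Top => Top
  | And B C => And (subst s B) (subst s C)
  | Mod a B => Mod a (subst s B)
  end.

Fixpoint variable_free (A : formula) : bool :=
  match A with
  | Var _ => false
  | Top => true
  | And B C => variable_free B && variable_free C
  | Mod _ B => variable_free B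
  end.

Fixpoint modalities_ge (n : nat) (A : formula) : bool :=
  match A with
  | Var _ | Top => true
  | And B C => modalities_ge n B && modalities_ge n C
  | Mod a B => (n <= mod_index a) && modalities_ge n B
  end.

Fixpoint is_word (A : formula) : bool :=
  match A with
  | Top => true
  | Dia _ B => is_word B
  | _ => false
  end.

Definition Fnabla (n : nat) : pred formula :=
  fun A => variable_free A && modalities_ge n A.

Definition Words (n : nat) : pred formula :=
  fun A => is_word A && modalities_ge n A.

(* [RCnabla A B] : the sequent A |- B is provable in RC^nabla. *)
Inductive RCnabla : formula -> formula -> Prop :=
  | RC_refl A : RCnabla A A
  | RC_top A : RCnabla A Top
  | RC_andl A B : RCnabla (And A B) A
  | RC_andr A B : RCnabla (And A B) B
  | RC_trans A B C : RCnabla A B -> RCnabla B C -> RCnabla A C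
  | RC_and A B C : RCnabla A B -> RCnabla A C -> RCnabla A (And B C)
  | RC_mod a A B : RCnabla A B -> RCnabla (Mod a A) (Mod a B)
  | RC_subst s A B : RCnabla A B -> RCnabla (subst s A) (subst s B)
  | RC_four a A : RCnabla (Mod a (Mod a A)) (Mod a A)
  | RC_dia_mon m n A : m < n -> RCnabla (Dia n A) (Dia m A)
  | RC_dia_and m n A B : m < n ->
      RCnabla (And (Dia n A) (Dia m B)) (Dia n (And A (Dia m B)))
  | RC_nab_mon m n A : m < n -> RCnabla (Nab n A) (Nab m A)
  | RC_nab_and m n A B : m < n ->
      RCnabla (And (Nab n A) (Nab m B)) (Nab n (And A (Nab m B)))
  | RC_nab_intro n A : RCnabla A (Nab n A)
  | RC_dia_nab n A : RCnabla (Dia n A) (Nab n A)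
  | RC_dia_nab_elim m n A : m <= n -> RCnabla (Dia m (Nab n A)) (Dia m A)
  | RC_nab_dia_elim m n A : m <= n -> RCnabla (Nab n (Dia m A)) (Dia m A).

Definition RCnabla_eq (A B : formula) : Prop := RCnabla A B /\ RCnabla B A.

(* Main.v *)
Require Import Defs.
From mathcomp Require Import all_boot.

Set Implicit Arguments.
Unset Strict Implicit.
Unset Printing Implicit Defensive.

(** Every formula of [Fnabla n] has, up to provable equality, a normal form
    /\_(i >= n) Nab i W_i (finite) with W_i in [Words i].  Three facts give
    this.  First, words of [Words n] are linearly ordered under Nab n, so two
    conjuncts at the same level merge into one.  Secondly,
    Nab k (Nab n A /\ C) = Nab n A /\ Nab k C and
    Dia k (Nab n A /\ C) = Dia n A /\ Dia k C for n < k, so both modalities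
    commute with the conjuncts of lower level.  Thirdly, Nab n of a normal form
    of level n is Nab n of a word; by downward induction on the level this
    reduces to Nab n (Nab n A /\ W) with A in [Words n] and W in
    [Words n.+1], where the linear order applies at level n.+1. *)

Local Notation "A |-- B" := (RCnabla A B) (at level 75, no associativity).
Local Notation "A -||- B" := (RCnabla_eq A B) (at level 75, no associativity).

(** * Provable equality and derived rules *)

Lemma req_refl A : A -||- A.
Proof. by split; exact: RC_refl. Qed.

Lemma req_sym A B : A -||- B -> B -||- A.
Proof. by case. Qed.

Lemma req_trans B A C : A -||- B -> B -||- C -> A -||- C.
Proof.
by move=> [AB BA] [BC CB]; split; [exact: RC_trans AB BC | exact: RC_trans CB BA].
Qed.

Lemma RC_andl_trans A B C : A |-- C -> And A B |-- C.
Proof. exact: RC_trans (RC_andl A B). Qed.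

Lemma RC_andr_trans A B C : B |-- C -> And A B |-- C.
Proof. exact: RC_trans (RC_andr A B). Qed.

Lemma RC_and_mono A A' B B' : A |-- A' -> B |-- B' -> And A B |-- And A' B'.
Proof.
by move=> hA hB; apply: RC_and; [exact: RC_andl_trans | exact: RC_andr_trans].
Qed.

Lemma RC_andC A B : And A B |-- And B A.
Proof. exact: RC_and (RC_andr A B) (RC_andl A B). Qed.

Lemma req_mod a A B : A -||- B -> Mod a A -||- Mod a B.
Proof. by case=> AB BA; split; exact: RC_mod. Qed.

Lemma req_and A A' B B' : A -||- A' -> B -||- B' -> And A B -||- And A' B'.
Proof. by move=> [? ?] [? ?]; split; exact: RC_and_mono. Qed.

Lemma nab_lift n A B : A |-- Nab n B -> Nab n A |-- Nab n B.
Proof. by move=> h; exact: RC_trans (RC_mod _ h) (RC_four _ _). Qed.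

Lemma dia_nab_lift n A B : A |-- Nab n B -> Dia n A |-- Dia n B.
Proof. by move=> h; exact: RC_trans (RC_mod _ h) (RC_dia_nab_elim _ (leqnn n)). Qed.

(** Lets a diamond be read as a [Nab] of its own level, so that it fits the shape of normal
    forms. *)
Lemma nab_dia n A : Nab n (Dia n A) -||- Dia n A.
Proof. by split; [exact: RC_nab_dia_elim | exact: RC_nab_intro]. Qed.

Lemma nab_and_dia m n A B : m < n ->
  And (Nab n A) (Dia m B) |-- Nab n (And A (Dia m B)).
Proof.
move=> ltmn; have [elim_m intro_m] := nab_dia m B.
apply: RC_trans (RC_and_mono (RC_refl _) intro_m) _.
apply: RC_trans (RC_nab_and _ _ ltmn) _.
exact: RC_mod (RC_and_mono (RC_refl _) elim_m).
Qed.

Lemma dia_and_low m n A B : m < n ->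
  Dia n (And A (Dia m B)) -||- And (Dia n A) (Dia m B).
Proof.
move=> ltmn; split; last exact: RC_dia_and.
apply: RC_and; first exact: RC_mod (RC_andl _ _).
apply: RC_trans (RC_mod _ (RC_andr _ _)) _.
exact: RC_trans (RC_dia_mon _ ltmn) (RC_four _ _).
Qed.

Lemma nab_nab_and m n A C : m < n ->
  Nab n (And (Nab m A) C) -||- And (Nab m A) (Nab n C).
Proof.
move=> ltmn; split.
  apply: RC_and; last exact: RC_mod (RC_andr _ _).
  apply: RC_trans (RC_mod _ (RC_andl _ _)) _.
  exact: RC_trans (RC_nab_mon _ ltmn) (RC_four _ _).
apply: RC_trans (RC_andC _ _) _.
exact: RC_trans (RC_nab_and _ _ ltmn) (RC_mod _ (RC_andC _ _)).
Qed.

(* The naive analogue of [nab_nab_and], with [Nab m A] on the right, fails: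
   [Dia n (Nab m A)] already entails [Dia m A]. *)
Lemma dia_nab_and m n A C : m < n ->
  Dia n (And (Nab m A) C) -||- And (Dia m A) (Dia n C).
Proof.
move=> ltmn; split.
  apply: RC_and; last exact: RC_mod (RC_andr _ _).
  apply: RC_trans (RC_mod _ (RC_andl _ _)) _.
  exact: RC_trans (RC_dia_mon _ ltmn) (RC_dia_nab_elim _ (leqnn m)).
apply: RC_trans (RC_andC _ _) _.
apply: RC_trans (RC_dia_and _ _ ltmn) _.
apply: RC_mod; apply: RC_trans (RC_andC _ _) _.
exact: RC_and_mono (RC_dia_nab _ _) (RC_refl _).
Qed.

(** * Words and their decomposition at a level *)

Lemma Words_Dia n k A : Words n (Dia k A) = (n <= k) && Words n A.
Proof. by rewrite /Words /= andbCA. Qed.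

Lemma WordsP n A : Words n A ->
  A = Top \/ exists k B, [/\ A = Dia k B, n <= k & Words n B].
Proof.
case: A => [p //| |//|[k|k] B]; first by left.
  by rewrite Words_Dia => /andP [? ?]; right; exists k, B.
by rewrite /Words.
Qed.

Fixpoint height (A : formula) : nat :=
  match A with
  | Mod _ B => (height B).+1
  | _ => 0
  end.

(** The successor makes the bound strict: a word of [Words n] with bound at most [n] has no modality
    left. *)
Fixpoint index_bound (A : formula) : nat :=
  match A with
  | Mod a B => maxn (mod_index a).+1 (index_bound B)
  | _ => 0
  end.

Lemma Words_ind (P : formula -> Prop) n :
  P Top -> (forall k A, n <= k -> Words n A -> P A -> P (Dia k A)) ->
  forall A, Words n A -> P A.
Proof.
move=> PT PD; elim=> [p //|//|//|[k|k] B IH]; last by rewrite /Words.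
by rewrite Words_Dia => /andP [? ?]; apply: PD => //; exact: IH.
Qed.

Lemma Words_le m n A : m <= n -> Words n A -> Words m A.
Proof.
move=> lemn; move: A; apply: Words_ind => // k A lenk _ wA.
by rewrite Words_Dia (leq_trans lemn lenk).
Qed.

(** The word is [A] with its final [Top] replaced by [Dia n B]; [dia_and_low] pulls this tail out
    through each [Dia k], as [n < k]. *)
Lemma Words_cat n A B : Words n.+1 A -> Words n B ->
  exists2 W, Words n W & W -||- And A (Dia n B).
Proof.
move=> wA wB; move: A wA; apply: Words_ind => [|k A ltnk _ [W wW eqW]].
  exists (Dia n B); first by rewrite Words_Dia leqnn.
  by split; [exact: RC_and (RC_top _) (RC_refl _) | exact: RC_andr].
exists (Dia k W); first by rewrite Words_Dia (ltnW ltnk).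
exact: req_trans (req_mod _ eqW) (dia_and_low _ _ ltnk).
Qed.

(** Cuts [A] at its first [Dia n]: [B] is the part before it, [C] the part after it. The removed
    [Dia n] makes the height inequality strict. *)
Lemma Words_split n A : Words n A -> Words n.+1 A \/
  exists B C, [/\ Words n.+1 B, Words n C, A -||- And B (Dia n C)
                & height B + height C < height A].
Proof.
move: A; apply: Words_ind => [|k A lenk wA IH]; first by left.
case: (ltngtP n k) lenk => // [ltnk|<-] _; last first.
  right; exists Top, A; split=> //.
  by split; [exact: RC_and (RC_top _) (RC_refl _) | exact: RC_andr].
case: IH => [wA' | [B [C [wB wC eqA hlt]]]]; first by left; rewrite Words_Dia ltnk.
right; exists (Dia k B), C; split=> //; first by rewrite Words_Dia ltnk.
exact: req_trans (req_mod _ eqA) (dia_and_low _ _ ltnk).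
Qed.

Lemma Words_index_bound n A : Words n A -> index_bound A <= n -> A = Top.
Proof.
case/WordsP=> [//|[k [B [-> lenk _]]]] /=.
by rewrite geq_max => /andP [/(leq_ltn_trans lenk)]; rewrite ltnn.
Qed.

(** * Linear comparison of words *)

Lemma dia_and_lift n A B C : A |-- Dia n.+1 B -> A |-- Dia n C ->
  A |-- Dia n (And B (Dia n C)).
Proof.
move=> hB hC; apply: RC_trans (RC_and hB hC) _.
exact: RC_trans (RC_dia_and _ _ (ltnSn n)) (RC_dia_mon _ (ltnSn n)).
Qed.

Lemma nab_and_lift n A B C : A |-- Nab n.+1 B -> A |-- Dia n C ->
  A |-- Nab n (And B (Dia n C)).
Proof.
move=> hB hC; apply: RC_trans (RC_and hB hC) _.
exact: RC_trans (nab_and_dia _ _ (ltnSn n)) (RC_nab_mon _ (ltnSn n)).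
Qed.

(* This asymmetric form is what makes the induction go through: the
   alternatives for the heads (at level n.+1) tell which of the two words to
   compare with the tail of the other, and either outcome suffices since
   [Dia n (Nab n X)] entails [Dia n X]. *)
Lemma Words_dia_or_nab n A B : Words n A -> Words n B ->
  A |-- Dia n B \/ B |-- Nab n A.
Proof.
(* The outer induction is on total height. The inner one, on the gap between [n] and the index
   bound, serves the case where neither word contains [Dia n] and only the level rises. *)
have [h] := ubnP (height A + height B).
elim: h n A B => // h IHh n A B; rewrite ltnS => leh.
have [d] := ubnP (maxn (index_bound A) (index_bound B) - n).
elim: d n => // d IHd n; rewrite ltnS => led wA wB.
have [bnd | ltn] := leqP (maxn (index_bound A) (index_bound B)) n.
  move: bnd; rewrite geq_max => /andP [bA bB].
  rewrite (Words_index_bound wA bA) (Words_index_bound wB bB).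
  by right; exact: RC_nab_intro.
have ltd : maxn (index_bound A) (index_bound B) - n.+1 < d.
  by apply: leq_trans led; rewrite ltn_sub2l.
have [wA1 | [A1 [A' [wA1 wA' [AA1 A1A] hA]]]] := Words_split wA;
have [wB1 | [B1 [B' [wB1 wB' [BB1 B1B] hB]]]] := Words_split wB.
- case: (IHd n.+1 ltd wA1 wB1) => hAB; [left | right]; apply: RC_trans hAB _.
  + exact: RC_dia_mon.
  + exact: RC_nab_mon.
- have hB1 : height A + height B1 < h.
    by apply: leq_trans leh; rewrite ltn_add2l (leq_ltn_trans _ hB) ?leq_addr.
  have hB' : height A + height B' < h.
    by apply: leq_trans leh; rewrite ltn_add2l (leq_ltn_trans _ hB) ?leq_addl.
  case: (IHh n.+1 A B1 hB1 wA1 wB1) => hAB.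
    case: (IHh n A B' hB' wA wB') => hAB'.
      left; apply: RC_trans _ (RC_mod _ B1B); exact: dia_and_lift.
    right; apply: RC_trans BB1 (RC_andr_trans _ _).
    exact: RC_trans (dia_nab_lift hAB') (RC_dia_nab _ _).
  right; apply: RC_trans BB1 (RC_andl_trans _ _).
  exact: RC_trans hAB (RC_nab_mon _ (ltnSn n)).
- have hA1 : height A1 + height B < h.
    by apply: leq_trans leh; rewrite ltn_add2r (leq_ltn_trans _ hA) ?leq_addr.
  have hA' : height B + height A' < h.
    by apply: leq_trans leh; rewrite addnC ltn_add2r (leq_ltn_trans _ hA) ?leq_addl.
  case: (IHh n.+1 A1 B hA1 wA1 wB1) => hAB.
    left; apply: RC_trans AA1 (RC_andl_trans _ _).
    exact: RC_trans hAB (RC_dia_mon _ (ltnSn n)).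
  (* The words are swapped on purpose: the second outcome, [A' |-- Nab n B], turns the tail
     [Dia n A'] into [Dia n B]. *)
  case: (IHh n B A' hA' wB wA') => hBA'.
    right; apply: RC_trans _ (RC_mod _ A1A); exact: nab_and_lift.
  left; apply: RC_trans AA1 (RC_andr_trans _ _).
  exact: dia_nab_lift.
- have hA1 : height A1 < height A by rewrite (leq_ltn_trans _ hA) ?leq_addr.
  have hA' : height A' < height A by rewrite (leq_ltn_trans _ hA) ?leq_addl.
  have hB1 : height B1 < height B by rewrite (leq_ltn_trans _ hB) ?leq_addr.
  have hB' : height B' < height B by rewrite (leq_ltn_trans _ hB) ?leq_addl.
  have h11 : height A1 + height B1 < h.
    by apply: leq_trans leh; rewrite -addSn leq_add // ltnW.
  have hAB' : height A + height B' < h by apply: leq_trans leh; rewrite ltn_add2l.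
  have hBA' : height B + height A' < h.
    by apply: leq_trans leh; rewrite addnC ltn_add2r.
  case: (IHh n.+1 A1 B1 h11 wA1 wB1) => hAB.
    case: (IHh n A B' hAB' wA wB') => hAB2.
      left; apply: RC_trans _ (RC_mod _ B1B); apply: dia_and_lift => //.
      exact: RC_trans AA1 (RC_andl_trans _ _).
    right; apply: RC_trans BB1 (RC_andr_trans _ _).
    exact: RC_trans (dia_nab_lift hAB2) (RC_dia_nab _ _).
  case: (IHh n B A' hBA' wB wA') => hBA2.
    right; apply: RC_trans _ (RC_mod _ A1A); apply: nab_and_lift => //.
    exact: RC_trans BB1 (RC_andl_trans _ _).
  left; apply: RC_trans AA1 (RC_andr_trans _ _).
  exact: dia_nab_lift.
Qed.

Lemma Words_nab_total n A B : Words n A -> Words n B ->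
  A |-- Nab n B \/ B |-- Nab n A.
Proof.
move=> wA wB; have [h|h] := Words_dia_or_nab wA wB; last by right.
by left; exact: RC_trans h (RC_dia_nab _ _).
Qed.

(** * Merging [Nab n A] with a word of higher level *)

Lemma nab_and_replace m n A C D : m < n -> C |-- Nab n D ->
  And (Nab m A) C |-- Nab m (And (Nab m A) D).
Proof.
move=> ltmn hCD; apply: RC_trans (RC_and_mono (RC_refl _) hCD) _.
exact: RC_trans (nab_nab_and _ _ ltmn).2 (RC_nab_mon _ ltmn).
Qed.

(** Allows the tail of a normal form to be replaced by a word that agrees with it only under
    [Nab n]. *)
Lemma nab_and_congr m n A C D : m < n -> Nab n C -||- Nab n D ->
  Nab m (And (Nab m A) C) -||- Nab m (And (Nab m A) D).
Proof.
move=> ltmn [CD DC]; split; apply: nab_lift; apply: (nab_and_replace _ ltmn).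
  exact: RC_trans (RC_nab_intro _ _) CD.
exact: RC_trans (RC_nab_intro _ _) DC.
Qed.

Lemma nab_and_absorb n A W : A |-- Nab n.+1 W ->
  Nab n (And (Nab n A) W) -||- Nab n A.
Proof.
move=> hAW; split; apply: nab_lift; first exact: RC_andl.
apply: RC_trans (RC_and (RC_nab_intro n A) hAW) _.
exact: nab_and_replace _ (ltnSn n) (RC_refl _).
Qed.

(** Only the part of [A] before its first [Dia n] competes with [W]: the stronger of the two stays,
    followed by the tail [Dia n C] of [A], if there is one. *)
Lemma nab_and_word n A W : Words n A -> Words n.+1 W ->
  exists2 V, Words n V & Nab n (And (Nab n A) W) -||- Nab n V.
Proof.
move=> wA wW; case: (Words_split wA) => [wA1 | [B [C [wB wC [ABC BCA] _]]]].
  case: (Words_nab_total wA1 wW) => h.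
    by exists A => //; exact: nab_and_absorb.
  exists W; first exact: Words_le (leqnSn n) wW.
  split; first exact: RC_mod (RC_andr _ _).
  apply: RC_mod; apply: RC_and (RC_refl _).
  exact: RC_trans h (RC_nab_mon _ (ltnSn n)).
case: (Words_nab_total wB wW) => h.
  exists A => //; apply: nab_and_absorb.
  exact: RC_trans ABC (RC_andl_trans _ h).
have [V wV eqV] := Words_cat wW wC.
exists V => //; apply: (@req_trans (Nab n (And W (Dia n C)))); last first.
  exact/req_mod/req_sym.
have [elimC _] := nab_dia n C.
split; apply: RC_mod; apply: RC_and.
- exact: RC_andr.
- apply: RC_andl_trans; apply: RC_trans (RC_mod _ ABC) _.
  exact: RC_trans (RC_mod _ (RC_andr _ _)) elimC.
- apply: RC_trans _ (RC_mod _ BCA); apply: nab_and_lift; last exact: RC_andr.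
  exact: RC_andl_trans.
- exact: RC_andl.
Qed.

(** * Normal forms and closure of normalizable formulas *)

Inductive normal_form : nat -> formula -> Prop :=
  | NF_top n : normal_form n Top
  | NF_and n W C : Words n W -> normal_form n.+1 C ->
      normal_form n (And (Nab n W) C).

Definition normalizable (n : nat) (A : formula) : Prop :=
  exists2 B, normal_form n B & A -||- B.

Lemma normalizable_eq n A B : A -||- B -> normalizable n B -> normalizable n A.
Proof. by move=> AB [C nC BC]; exists C => //; exact: req_trans AB BC. Qed.

Lemma normalizable_cons n W C : Words n W -> normalizable n.+1 C ->
  normalizable n (And (Nab n W) C).
Proof.
move=> wW [D nD CD]; exists (And (Nab n W) D); first exact: NF_and.
exact: req_and (req_refl _) CD.
Qed.

(** Normal forms list consecutive levels, so a missing level is padded with the trivial conjunct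
    [Nab n Top]. *)
Lemma normalizable_lift n C : normalizable n.+1 C -> normalizable n C.
Proof.
move=> nC; apply: (@normalizable_eq n C (And (Nab n Top) C)).
  split; last exact: RC_andr.
  exact: RC_and (RC_trans (RC_top _) (RC_nab_intro _ _)) (RC_refl _).
exact: normalizable_cons.
Qed.

Lemma normalizable_le m n C : m <= n -> normalizable n C -> normalizable m C.
Proof.
move=> lemn; rewrite -(subnK lemn); elim: (n - m) => // d IHd nC.
by apply/IHd/normalizable_lift.
Qed.

Lemma normalizable_nab_word n W : Words n W -> normalizable n (Nab n W).
Proof.
move=> wW; exists (And (Nab n W) Top); first exact: NF_and wW (NF_top _).
by split; [exact: RC_and (RC_refl _) (RC_top _) | exact: RC_andl].
Qed.

Lemma normal_form_nab n A : normal_form n A ->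
  exists2 W, Words n W & Nab n A -||- Nab n W.
Proof.
elim=> {n A} [n | n A C wA _ [W wW eqC]]; first by exists Top => //; exact: req_refl.
have [V wV eqV] := nab_and_word wA wW; exists V => //.
exact: req_trans (nab_and_congr _ (ltnSn n) eqC) eqV.
Qed.

Lemma normalizable_and n A B :
  normalizable n A -> normalizable n B -> normalizable n (And A B).
Proof.
case=> [A' nA eqA] [B' nB eqB].
apply: normalizable_eq (req_and eqA eqB) _.
elim: nA B' nB {A B eqA eqB} => {n A'} [n | n A C wA nC IH] B nB.
  exists B => //.
  by split; [exact: RC_andr | exact: RC_and (RC_top _) (RC_refl _)].
case: nB wA nC IH => {n B} [n | n B D wB nD] wA nC IH.
  exists (And (Nab n A) C); first exact: NF_and.
  by split; [exact: RC_andl | exact: RC_and (RC_refl _) (RC_top _)].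
(* Of two comparable words at one level, the stronger alone survives. *)
have [W wW eqW] : exists2 W, Words n W & And (Nab n A) (Nab n B) -||- Nab n W.
  case: (Words_nab_total wA wB) => h.
    exists A => //; split; first exact: RC_andl.
    exact: RC_and (RC_refl _) (nab_lift h).
  exists B => //; split; first exact: RC_andr.
  exact: RC_and (nab_lift h) (RC_refl _).
apply: (@normalizable_eq _ _ (And (And (Nab n A) (Nab n B)) (And C D))).
  split; apply: RC_and; apply: RC_and_mono;
    by [exact: RC_andl | exact: RC_andr].
apply: normalizable_eq (req_and eqW (req_refl _)) _.
exact: normalizable_cons (IH _ nD).
Qed.

(** [Nab k] passes the conjuncts of level below [k]; on reaching level [k], the rest collapses to
    [Nab k] of a word. *)
Lemma normalizable_nab n k A : n <= k -> normalizable n A ->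
  normalizable n (Nab k A).
Proof.
move=> lenk [B nB eqA]; apply: normalizable_eq (req_mod _ eqA) _.
elim: nB lenk {A eqA} => {n B} [n | n A C wA nC IH] lenk.
  exists Top; first exact: NF_top.
  by split; [exact: RC_top | exact: RC_nab_intro].
case: (ltngtP n k) lenk => // [ltnk|<-] _.
  apply: normalizable_eq (nab_nab_and _ _ ltnk) _.
  exact: normalizable_cons (IH _).
have [W wW eqW] := normal_form_nab (NF_and wA nC).
exact: normalizable_eq eqW (normalizable_nab_word wW).
Qed.

Lemma normalizable_dia_word n W : Words n W -> normalizable n (Dia n W).
Proof.
move=> wW; apply: normalizable_eq (req_sym (nab_dia _ _)) _.
by apply: normalizable_nab_word; rewrite Words_Dia leqnn.
Qed.

Lemma normalizable_dia n k A : n <= k -> normalizable n A ->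
  normalizable n (Dia k A).
Proof.
move=> lenk [B nB eqA]; apply: normalizable_eq (req_mod _ eqA) _.
elim: nB lenk {A eqA} => {n B} [n | n A C wA nC IH] lenk.
  exact: normalizable_le lenk (normalizable_dia_word _).
case: (ltngtP n k) lenk => // [ltnk|<-] _.
  apply: normalizable_eq (dia_nab_and _ _ ltnk) _.
  apply: normalizable_eq (req_and (req_sym (nab_dia _ _)) (req_refl _)) _.
  by apply: normalizable_cons (IH _) => //; rewrite Words_Dia leqnn.
have [W wW [hW1 hW2]] := normal_form_nab (NF_and wA nC).
apply: normalizable_eq (normalizable_dia_word wW).
(* [Dia n] of a formula depends only on its [Nab n], so the collapse under [Nab n] carries over. *)
split; apply: dia_nab_lift.
  exact: RC_trans (RC_nab_intro _ _) hW1.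
exact: RC_trans (RC_nab_intro _ _) hW2.
Qed.

Theorem theorem2 (n : nat) (A : formula) (hA : Fnabla n A) :
  exists W : formula, Words n W /\ RCnabla_eq (Nab n A) (Nab n W).
Proof.
suff [B nB eqA] : normalizable n A.
  have [W wW eqB] := normal_form_nab nB.
  by exists W; split=> //; exact: req_trans (req_mod _ eqA) eqB.
elim: A hA => [p //| _ |B IHB C IHC|a B IHB] /=.
- by exists Top; [exact: NF_top | exact: req_refl].
- case/andP=> /= /andP [vB vC] /andP [gB gC].
  by apply: normalizable_and; [apply: IHB | apply: IHC]; apply/andP.
- case/andP=> /= vB /andP [leni gB].
  have nB : normalizable n B by apply: IHB; apply/andP.
  by case: a leni => k /= lenk; [exact: normalizable_dia | exact: normalizable_nab].
Qed.
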